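(* $Q_{A(\mathbb{I},3)} \ge Q_{U(\mathbb{I},\emptyset,3)} \ge 2$, where $\mathbb{I}$ denotes the ring of Hurwitz integers.
   Context: $R=\mathbb{I}$ is the ring of Hurwitz integers: all quaternions $z=q+r\mathbf{i}+s\mathbf{j}+t\mathbf{k}$ with either $q,r,s,t\in\mathbb{Z}$ or $q,r,s,t\in\frac12+\mathbb{Z}$, with the usual quaternion multiplication. Its norm is $N(z)=q^2+r^2+s^2+t^2\in\mathbb{Z}$. For a positive integer $m$, $\mathrm{rad}(m)$ is the largest square-free positive divisor of $m$. For $a=(a_1,\dots,a_n)\in R^n$ with all $a_j\neq 0$, the quality is $$q(a)=\frac{\log(\max(N(a_1),\dots,N(a_n)))}{\log(\mathrm{rad}(N(a_1\cdots a_n)))}.$$ For an infinite (countable) set $S=\{a^{(1)},a^{(2)},\dots\}$ of such $n$-tuples (enumerated without repetition), $Q_S=\limsup_{k\to\infty}q(a^{(k)})$ (possibly $+\infty$). The finitely many tuples consisting only of units, for which the denominator is $0$, are disregarded in the limsup. $A(R,n)$ is the set of $a=(a_1,\dots,a_n)\in R^n$ with all $a_j\ne 0$ satisfying: (Z) $a_1+\dots+a_n=0$; (S1) there are no $b_1,\dots,b_n\in\{0,1\}$ and indices $i,j$ with $b_i=0$, $b_j=1$ and $\sum_{k=1}^n b_ka_k=0$; (G1) both the left g.c.d. and the right g.c.d. of $a_1,\dots,a_n$ equal $1$ (up to units). $U(R,\emptyset,n)$ is the set of $a=(a_1,\dots,a_n)\in R^n$ with all $a_j\neq 0$ satisfying: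 (Z) $a_1+\dots+a_n=0$; (S2) there are no $b_1,\dots,b_n\in\{-1,0,1\}$ and indices $i,j$ with $b_i=0$, $b_j=1$ and $\sum_{k=1}^n b_ka_k=0$; (G2) for all $i<j$, both the left g.c.d. and the right g.c.d. of $a_i$ and $a_j$ equal $1$ (up to units). *)

(* Defs.v *)
From HB Require Import structures.
From mathcomp Require Import all_boot all_order all_algebra.
From mathcomp Require Import archimedean ring lra.
From mathcomp Require Import all_classical all_reals all_analysis.

Set Implicit Arguments.
Unset Strict Implicit.
Unset Printing Implicit Defensive.

Import Order.TTheory GRing.Theory Num.Theory.

Local Open Scope ring_scope.
Local Open Scope classical_set_scope.

(* Rational quaternions Quat q r s t = q + r i + s j + t k. *)

Record quat : Type := Quat { qre : rat; qi : rat; qj : rat; qk : rat }.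

Definition quat_to (z : quat) := (qre z, qi z, qj z, qk z).
Definition quat_from (p : rat * rat * rat * rat) :=
  let: (a, b, c, d) := p in Quat a b c d.

Lemma quat_toK : cancel quat_to quat_from.
Proof. by case. Qed.

HB.instance Definition _ := Countable.copy quat (can_type quat_toK).

Definition addq (x y : quat) : quat :=
  Quat (qre x + qre y) (qi x + qi y) (qj x + qj y) (qk x + qk y).

Definition oppq (x : quat) : quat :=
  Quat (- qre x) (- qi x) (- qj x) (- qk x).

Definition mulq (x y : quat) : quat :=
  Quat (qre x * qre y - qi x * qi y - qj x * qj y - qk x * qk y)
       (qre x * qi y + qi x * qre y + qj x * qk y - qk x * qj y)
       (qre x * qj y - qi x * qk y + qj x * qre y + qk x * qi y)
       (qre x * qk y + qi x * qj y - qj x * qi y + qk x * qre y).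

Lemma quat_addA : associative addq.
Proof. by move=> x y z; rewrite /addq /=; congr Quat; ring. Qed.

Lemma quat_addC : commutative addq.
Proof. by move=> x y; rewrite /addq /=; congr Quat; ring. Qed.

Lemma quat_add0 : left_id (Quat 0 0 0 0) addq.
Proof. by case=> a b c d; rewrite /addq /=; congr Quat; ring. Qed.

Lemma quat_addN : left_inverse (Quat 0 0 0 0) oppq addq.
Proof. by move=> x; rewrite /addq /=; congr Quat; ring. Qed.

HB.instance Definition _ :=
  GRing.isZmodule.Build quat quat_addA quat_addC quat_add0 quat_addN.

Lemma quat_mulA : associative mulq.
Proof. by move=> x y z; rewrite /mulq /=; congr Quat; ring. Qed.

Lemma quat_mul1l : left_id (Quat 1 0 0 0) mulq.
Proof. by case=> a b c d; rewrite /mulq /=; congr Quat; ring. Qed.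

Lemma quat_mul1r : right_id (Quat 1 0 0 0) mulq.
Proof. by case=> a b c d; rewrite /mulq /=; congr Quat; ring. Qed.

Lemma quat_mulDl : left_distributive mulq addq.
Proof. by move=> x y z; rewrite /mulq /addq /=; congr Quat; ring. Qed.

Lemma quat_mulDr : right_distributive mulq addq.
Proof. by move=> x y z; rewrite /mulq /addq /=; congr Quat; ring. Qed.

Lemma quat_1_neq0 : Quat 1 0 0 0 != 0.
Proof. by apply/eqP => -[]. Qed.

HB.instance Definition _ :=
  GRing.Zmodule_isNzRing.Build quat quat_mulA quat_mul1l quat_mul1r
    quat_mulDl quat_mulDr quat_1_neq0.

Definition normq (z : quat) : rat :=
  qre z ^+ 2 + qi z ^+ 2 + qj z ^+ 2 + qk z ^+ 2.

Definition conjq (z : quat) : quat := Quat (qre z) (- qi z) (- qj z) (- qk z).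

Lemma quat_mulE (x y : quat) : x * y = mulq x y. Proof. by []. Qed.

Lemma normqM (x y : quat) : normq (x * y) = normq x * normq y.
Proof. by rewrite quat_mulE /normq /mulq /=; ring. Qed.

Lemma mulq_conj (z : quat) : z * conjq z = Quat (normq z) 0 0 0.
Proof. by rewrite quat_mulE /normq /mulq /=; congr Quat; ring. Qed.

Lemma mul_conjq (z : quat) : conjq z * z = Quat (normq z) 0 0 0.
Proof. by rewrite quat_mulE /normq /mulq /=; congr Quat; ring. Qed.

Definition is_hurwitz : {pred quat} := fun z =>
  [&& qre z \is a Num.int, qi z \is a Num.int,
      qj z \is a Num.int & qk z \is a Num.int]
  || [&& qre z - 2^-1 \is a Num.int, qi z - 2^-1 \is a Num.int,
         qj z - 2^-1 \is a Num.int & qk z - 2^-1 \is a Num.int].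

Lemma is_hurwitzP (z : quat) :
  reflect (exists (e : bool) (a b c d : int),
    z = Quat (a%:~R + e%:R / 2) (b%:~R + e%:R / 2)
             (c%:~R + e%:R / 2) (d%:~R + e%:R / 2))
    (z \in is_hurwitz).
Proof.
apply: (iffP idP) => [|[e [a [b [c [d ->]]]]]].
  case/orP => /and4P[/intrP[a ea] /intrP[b eb] /intrP[c ec] /intrP[d ed]].
    by exists false, a, b, c, d; case: z ea eb ec ed => /= ? ? ? ? -> -> -> ->;
       congr Quat; ring.
  exists true, a, b, c, d; case: z ea eb ec ed => /= ? ? ? ?.
  by rewrite -!/(_ - _) => /eqP + /eqP + /eqP + /eqP;
    rewrite !subr_eq => /eqP-> /eqP-> /eqP-> /eqP->; congr Quat; field.
by rewrite unfold_in /is_hurwitz /=; case: e;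
  rewrite ?mul0r ?addr0 ?mul1r ?addrK !intr_int ?orbT.
Qed.

Lemma int_parity (m : int) : exists (e : bool) (n : int), m = n * 2 + e%:R.
Proof.
have := divz_eq m 2; have := modz_ge0 m (isT : 2 != 0 :> int).
have := ltz_mod m (isT : 2 != 0 :> int).
case: (m %% 2)%Z => [[|[|//]]|//] _ _ ->.
- by exists false, (m %/ 2)%Z.
- by exists true, (m %/ 2)%Z.
Qed.

Lemma is_hurwitzB (x y : quat) :
  x \in is_hurwitz -> y \in is_hurwitz -> x - y \in is_hurwitz.
Proof.
move=> /is_hurwitzP[e [a [b [c [d ->]]]]] /is_hurwitzP[f [a' [b' [c' [d' ->]]]]].
pose k : int := (~~ e && f)%:R.
apply/is_hurwitzP; exists (e (+) f), (a - a' - k), (b - b' - k),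
  (c - c' - k), (d - d' - k).
rewrite {}/k; case: e; case: f;
  by congr Quat => /=; rewrite !rmorphD !rmorphN /=; field.
Qed.

Lemma is_hurwitzM (x y : quat) :
  x \in is_hurwitz -> y \in is_hurwitz -> x * y \in is_hurwitz.
Proof.
move=> /is_hurwitzP[e [a [b [c [d ->]]]]] /is_hurwitzP[f [a' [b' [c' [d' ->]]]]].
have [g [m am]] := int_parity (a + b + c + d).
have [g' [m' am']] := int_parity (a' + b' + c' + d').
have {am} -> : a = m * 2 + g%:R - b - c - d by rewrite -am; ring.
have {am'} -> : a' = m' * 2 + g'%:R - b' - c' - d' by rewrite -am'; ring.
set a1 : int := m * 2 + g%:R - b - c - d.
set a1' : int := m' * 2 + g'%:R - b' - c' - d'.
have Ea1 : (a1%:~R = m%:~R * 2 + g%:R - b%:~R - c%:~R - d%:~R :> rat).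
  by rewrite /a1; case: (g); ring.
have Ea1' : (a1'%:~R = m'%:~R * 2 + g'%:R - b'%:~R - c'%:~R - d'%:~R :> rat).
  by rewrite /a1'; case: (g'); ring.
clearbody a1 a1'.
pose k : int := (e && f && (g || g'))%:R.
pose E : int := e%:R; pose F : int := f%:R.
apply/is_hurwitzP; exists ((f && g) (+) (e && g') (+) (e && f)),
  (a1 * a1' - b * b' - c * c' - d * d'
    + F * (m - b - c - d) + E * (m' - b' - c' - d') + k - E * F),
  (a1 * b' + b * a1' + c * d' - d * c' + F * (m - d) + E * (m' - c') + k),
  (a1 * c' - b * d' + c * a1' + d * b' + F * (m - b) + E * (m' - d') + k),
  (a1 * d' + b * c' - c * b' + d * a1' + F * (m - c) + E * (m' - b') + k).
rewrite /E /F /k {E F k} quat_mulE /mulq /=.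
congr Quat; rewrite !(rmorphD, rmorphN, rmorphM) /= Ea1 Ea1' {Ea1 Ea1'}.
all: by case: e; case: f; case: g; case: g' => /=; field.
Qed.

Lemma is_hurwitz_subring : subring_closed is_hurwitz.
Proof.
split; [|exact: is_hurwitzB|exact: is_hurwitzM].
by apply/is_hurwitzP; exists false, 1, 0, 0, 0; congr Quat; rewrite /= mul0r addr0.
Qed.

HB.instance Definition _ :=
  GRing.isSubringClosed.Build quat is_hurwitz is_hurwitz_subring.

Record hurwitz : Type :=
  Hurwitz { hval :> quat; hvalP : hval \in is_hurwitz }.

HB.instance Definition _ := [isSub for hval].
HB.instance Definition _ := [Countable of hurwitz by <:].
HB.instance Definition _ := [SubChoice_isSubNzRing of hurwitz by <:].

Definition hnorm (z : hurwitz) : nat := `|numq (normq z)|%N.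

Lemma hnormE (z : hurwitz) : (hnorm z)%:R = normq z.
Proof.
have N0 : 0 <= normq z by rewrite /normq !addr_ge0 ?sqr_ge0.
have : normq z \is a Num.int.
  case: z {N0} => z /= /is_hurwitzP[e [a [b [c [d ->]]]]].
  apply/intrP; exists (a ^+ 2 + b ^+ 2 + c ^+ 2 + d ^+ 2
    + e%:R * (a + b + c + d + 1)).
  rewrite /normq !(rmorphD, rmorphXn, rmorphM) /=.
  by case: e => /=; field.
case/intrP => m em; rewrite em ler0z in N0; rewrite /hnorm em numq_int.
by rewrite natr_absz ger0_norm.
Qed.

Lemma hnormM (x y : hurwitz) : hnorm (x * y) = (hnorm x * hnorm y)%N.
Proof.
by apply: (@mulrIn rat 1); rewrite ?oner_neq0// natrM !hnormE normqM.
Qed.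

Lemma hnorm1 : hnorm 1 = 1%N. Proof. by []. Qed.

Lemma is_hurwitz_conj (z : quat) : z \in is_hurwitz -> conjq z \in is_hurwitz.
Proof.
move=> /is_hurwitzP[e [a [b [c [d ->]]]]].
apply/is_hurwitzP; exists e, a, (- b - e%:R), (- c - e%:R), (- d - e%:R).
by case: e; congr Quat; rewrite /= !rmorphD !rmorphN /=; field.
Qed.

Definition conjh (z : hurwitz) : hurwitz := Hurwitz (is_hurwitz_conj (hvalP z)).

Definition hunit : {pred hurwitz} := fun z => hnorm z == 1%N.
Definition hinv (z : hurwitz) : hurwitz := if z \in hunit then conjh z else z.

Lemma hmulVr : {in hunit, left_inverse 1 hinv *%R}.
Proof.
move=> z uz; apply: val_inj; rewrite /hinv uz /= mul_conjq -hnormE.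
by move: uz; rewrite unfold_in => /eqP->.
Qed.

Lemma hdivrr : {in hunit, right_inverse 1 hinv *%R}.
Proof.
move=> z uz; apply: val_inj; rewrite /hinv uz /= mulq_conj -hnormE.
by move: uz; rewrite unfold_in => /eqP->.
Qed.

Lemma hunitP (x y : hurwitz) : y * x = 1 /\ x * y = 1 -> x \in hunit.
Proof.
case=> _ /(congr1 hnorm); rewrite hnormM hnorm1 => /eqP.
by rewrite muln_eq1 => /andP[].
Qed.

Lemma hinv_out : {in [predC hunit], hinv =1 id}.
Proof. by move=> x /negbTE ux; rewrite /hinv ux. Qed.

HB.instance Definition _ :=
  GRing.NzRing_hasMulInverse.Build hurwitz hmulVr hdivrr hunitP hinv_out.

Definition squarefree (m : nat) : bool :=
  all (fun d => (d ^ 2 %| m)%N ==> (d == 1%N)) (divisors m).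

Definition rad (m : nat) : nat :=
  (\max_(d <- divisors m | squarefree d) d)%N.

Section Conditions.
Variables (R : nzRingType) (n : nat).
Implicit Type a : {ffun 'I_n -> R}.

(* d left-divides x when x = d * y, and right-divides x when x = y * d. *)

Definition is_left_gcd (s : set R) (g : R) : Prop :=
  (forall x, s x -> exists y, x = g * y) /\
  (forall d, (forall x, s x -> exists y, x = d * y) -> exists y, g = d * y).

Definition is_right_gcd (s : set R) (g : R) : Prop :=
  (forall x, s x -> exists y, x = y * g) /\
  (forall d, (forall x, s x -> exists y, x = y * d) -> exists y, g = y * d).

Definition nonzero a : Prop := forall i, a i != 0.

Definition condZ a : Prop := \sum_i a i = 0.

Definition no_partial_sum (coefs : seq int) a : Prop :=
  ~ exists (b : 'I_n -> int) (i j : 'I_n),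
      [/\ forall k, b k \in coefs, b i = 0, b j = 1 & \sum_k a k *~ b k = 0].

Definition condS1 a : Prop := no_partial_sum [:: 0; 1] a.

Definition condS2 a : Prop := no_partial_sum [:: -1; 0; 1] a.

Definition condG1 a : Prop :=
  is_left_gcd (range a) 1 /\ is_right_gcd (range a) 1.

Definition condG2 a : Prop := forall i j : 'I_n, (i < j)%N ->
  is_left_gcd [set a i; a j] 1 /\ is_right_gcd [set a i; a j] 1.

Definition tuplesA : set {ffun 'I_n -> R} :=
  [set a | [/\ nonzero a, condZ a, condS1 a & condG1 a]].

(* U(R, F, n) for F empty *)
Definition tuplesU : set {ffun 'I_n -> R} :=
  [set a | [/\ nonzero a, condZ a, condS2 a & condG2 a]].

End Conditions.

Arguments tuplesA R n : clear implicits.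
Arguments tuplesU R n : clear implicits.

Section Quality.
Variables (K : realType) (n : nat).
Implicit Types (a : {ffun 'I_n -> hurwitz}) (S : set {ffun 'I_n -> hurwitz}).

Definition quality a : K :=
  ln (\max_(i < n) hnorm (a i))%N%:R / ln (rad (hnorm (\prod_(i < n) a i)))%:R.

Definition nonunits S : set {ffun 'I_n -> hurwitz} :=
  S `&` [set a | ~ forall i, a i \is a GRing.unit].

Definition is_Q S (l : \bar K) : Prop :=
  exists e : nat -> {ffun 'I_n -> hurwitz},
    set_bij [set: nat] (nonunits S) e /\
    l = limn_esup (fun k => (quality (e k))%:E).

(* The value does not depend on the enumeration, see [is_Q_unique]; it is -oo
   if no enumeration exists, that is, if S is finite. *)
Definition Q S : \bar K := xget -oo%E (is_Q S).

Lemma limn_esup_inj_le (u : nat -> \bar K) (s : nat -> nat) :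
  injective s -> (limn_esup (fun k => u (s k)) <= limn_esup u)%E.
Proof.
move=> sI; have sN m : exists N, forall k, (N <= k)%N -> (m <= s k)%N.
  elim: m => [|m [N HN]]; first by exists 0%N.
  have [[k0 k0m]|nk0] := pselect (exists k0, s k0 = m).
    exists (maxn N k0.+1) => k; rewrite geq_max => /andP[Nk k0k].
    rewrite ltn_neqAle HN// andbT -k0m; apply/eqP => /sI k0E.
    by rewrite k0E ltnn in k0k.
  exists N => k Nk; rewrite ltn_neqAle HN// andbT.
  by apply/eqP => mk; apply: nk0; exists k.
rewrite !limn_esup_lim !(cvg_lim _ (@cvg_esups_inf _ _))//.
apply: le_ereal_inf_tmp => _ [m _ <-]; have [N HN] := sN m.
apply: (@le_trans _ _ (esups (fun k => u (s k)) N)).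
  by apply: ereal_inf_lbound; exists N.
apply: ereal_sup_le => _ [k /= Nk <-].
by exists (s k) => //=; exact: HN.
Qed.

Lemma is_Q_unique S l l' : is_Q S l -> is_Q S l' -> l = l'.
Proof.
suff H m m' : is_Q S m -> is_Q S m' -> (m <= m')%E.
  by move=> Ql Ql'; apply/eqP; rewrite eq_le !H.
move=> [e [[eS eI _] ->]] [e' [[_ _ e'S] ->]].
have /choice[s sE] k : exists j, e' j = e k.
  by have [j _ je] := e'S _ (eS k I); exists j.
rewrite (_ : (fun k => (quality (e k))%:E) =
             (fun k => (quality (e' (s k)))%:E)); last first.
  by apply/funext => k; rewrite sE.
apply: (@limn_esup_inj_le (fun k => (quality (e' k))%:E)) => i j sij.
by apply: eI; rewrite ?in_setT// -!sE sij.
Qed.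

Lemma QE S l : is_Q S l -> Q S = l.
Proof.
move=> Ql; apply/esym/(is_Q_unique Ql).
by apply: (@xgetPex _ -oo%E (is_Q S)); exists l.
Qed.

End Quality.

Arguments Q K [n] S.

(* Main.v *)
Require Import Defs.
From mathcomp Require Import all_boot all_order all_algebra.
From mathcomp Require Import all_classical all_reals all_analysis.
From mathcomp Require Import zify ring lra.

(** Write (2 + i)^m = x + y i. The Gaussian triples (x + y i, - x + y i, - 2 y i)
    sum to zero. Two of the entries have norm 5^m, while the third has norm
    (2 y)^2, which is prime to 5. A common one-sided divisor of two entries
    divides all three, so its norm divides two coprime integers and it is a
    unit. The radical of the product of the norms divides 10 |y| and
    |y| <= 5^(m/2), so the quality is at least log (5^m) / log (10 * 5^(m/2)),
    which tends to 2. *)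

Import Order.TTheory GRing.Theory Num.Theory.
Import numFieldNormedType.Exports.

Local Open Scope ring_scope.

(** * Upper limits and bounds on the radical *)

Lemma le_limn_esup (K : realType) (u v : nat -> \bar K) :
  (forall k, (u k <= v k)%E) -> (limn_esup u <= limn_esup v)%E.
Proof.
move=> uv; rewrite !limn_esup_lim !(cvg_lim _ (@cvg_esups_inf _ _))//.
apply: le_ereal_inf_tmp => _ [m _ <-].
apply: (@le_trans _ _ (esups u m)); first by apply: ereal_inf_lbound; exists m.
apply: ge_ereal_sup => _ [k /= mk <-]; apply: (le_trans (uv k)).
by apply: ereal_sup_ubound; exists k.
Qed.

(** A prime dividing [d / gcd(d, m)] divides [d], hence [m ^ k] and [m], hence the gcd as well; its
    square would then divide [d]. *)
Lemma squarefree_dvdn_exp (d m k : nat) :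
  (0 < d)%N -> squarefree d -> (d %| m ^ k)%N -> (d %| m)%N.
Proof.
move=> d_gt0 /allP sfd dmk.
have gd : (gcdn d m %| d)%N by exact: dvdn_gcdl.
suff : (d %/ gcdn d m == 1)%N.
  by move=> /eqP h1; rewrite -(divnK gd) h1 mul1n dvdn_gcdr.
apply: contraT => h_neq1; set p := pdiv (d %/ gcdn d m).
have h_gt0 : (0 < d %/ gcdn d m)%N.
  by rewrite divn_gt0 ?gcdn_gt0 ?d_gt0// dvdn_leq.
have p_pr : prime p by rewrite pdiv_prime// ltn_neqAle eq_sym h_neq1 h_gt0.
have ph : (p %| d %/ gcdn d m)%N by exact: pdiv_dvd.
have pd : (p %| d)%N by rewrite -(divnK gd) dvdn_mulr.
have pm : (p %| m)%N.
  by have := dvdn_trans pd dmk; rewrite Euclid_dvdX// => /andP[].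
have p2d : (p ^ 2 %| d)%N.
  by rewrite -(divnK gd) expnS expn1 dvdn_mul// dvdn_gcd pd.
have /sfd : p \in divisors d by rewrite -dvdn_divisors.
by rewrite p2d => /eqP p1; rewrite p1 in p_pr.
Qed.

Lemma rad_le (m r k : nat) :
  (0 < m)%N -> (0 < r)%N -> (m %| r ^ k)%N -> (Defs.rad m <= r)%N.
Proof.
move=> m_gt0 r_gt0 mr; apply/bigmax_leqP_seq => d.
rewrite -dvdn_divisors// => dm sfd; apply: dvdn_leq => //.
apply: (squarefree_dvdn_exp d r k) => //; first exact: dvdn_gt0 dm.
exact: dvdn_trans dm mr.
Qed.

Lemma squarefree_prime (p : nat) : prime p -> squarefree p.
Proof.
move=> p_pr; apply/allP => d _; apply/implyP => d2p.
have : (d %| p)%N by apply: dvdn_trans d2p; rewrite expnS dvdn_mulr.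
have [_ dvp] := primeP p_pr; move=> /dvp/orP[//|/eqP dp].
have := dvdn_leq (prime_gt0 p_pr) d2p; have := prime_gt1 p_pr.
rewrite dp expnS expn1; nia.
Qed.

(** Serves to keep the logarithm in the denominator of the quality positive. *)
Lemma rad_ge_prime (p m : nat) :
  prime p -> (0 < m)%N -> (p %| m)%N -> (p <= Defs.rad m)%N.
Proof.
move=> p_pr m_gt0 pm; apply: (leq_bigmax_seq (F := id)).
  by rewrite -dvdn_divisors.
exact: squarefree_prime.
Qed.

Lemma hnorm0 : hnorm 0 = 0%N. Proof. by []. Qed.

Lemma unit_hnorm (z : hurwitz) : (z \is a GRing.unit) = (hnorm z == 1%N).
Proof. by []. Qed.

(** * Zero-sum triples: from norms to membership in U and A *)

Section Triples.
Implicit Types a : {ffun 'I_3 -> hurwitz}.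

Lemma ord3_third (i j : 'I_3) : i != j ->
  exists k, [/\ k != i, k != j & forall l, [|| l == i, l == j | l == k]].
Proof.
pose k (m : nat) (h : (m < 3)%N) : 'I_3 := Ordinal h.
case: i j => [[|[|[|//]]] ilt] [[|[|[|//]]] jlt] // _.
- by exists (k 2%N isT); split=> // -[[|[|[|]]] ?].
- by exists (k 1%N isT); split=> // -[[|[|[|]]] ?].
- by exists (k 2%N isT); split=> // -[[|[|[|]]] ?].
- by exists (k 0%N isT); split=> // -[[|[|[|]]] ?].
- by exists (k 1%N isT); split=> // -[[|[|[|]]] ?].
- by exists (k 0%N isT); split=> // -[[|[|[|]]] ?].
Qed.

Lemma sum_ord3 (V : zmodType) (f : 'I_3 -> V) (i j k : 'I_3) :
  i != j -> k != i -> k != j -> \sum_l f l = f i + f j + f k.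
Proof.
move=> ij ki kj; rewrite (bigD1 i)//= (bigD1 j) 1?eq_sym//= (bigD1 k)/=; last first.
  by rewrite ki kj.
rewrite big1 ?addr0 ?addrA// => l.
by case: i j k l ij ki kj => [[|[|[|//]]] ?] [[|[|[|//]]] ?] [[|[|[|//]]] ?]
  [[|[|[|//]]] ?].
Qed.

(** The third entry is minus the sum of the other two. Applied with [P] the divisibility by a fixed
    [d] on one side. *)
Lemma condZ_closed (P : hurwitz -> Prop) a (i j : 'I_3) : condZ a -> i != j ->
  (forall x y, P x -> P y -> P (- (x + y))) -> P (a i) -> P (a j) ->
  forall k, P (a k).
Proof.
move=> aZ ij PD Pi Pj; have [k [ki kj all3]] := ord3_third i j ij.
move=> l; have /or3P[/eqP->//|/eqP->//|/eqP->] := all3 l.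
have -> : a k = - (a i + a j); last exact: PD.
apply/eqP; rewrite -addr_eq0 addrC -(sum_ord3 _ a i j k)//; exact/eqP.
Qed.

Lemma condG2_coprime_hnorm a (i j : 'I_3) : condZ a ->
  coprime (hnorm (a i)) (hnorm (a j)) -> condG2 a.
Proof.
move=> aZ cop i' j' ij'; have {}ij' : i' != j' by rewrite neq_ltn ij'.
have unit_d (d : hurwitz) :
    (forall k, (hnorm d %| hnorm (a k))%N) -> d \is a GRing.unit.
  by move=> dN; rewrite unit_hnorm -dvdn1 -(eqP cop) dvdn_gcd !dN.
split; split.
- by move=> x _; exists x; rewrite mul1r.
- move=> d dab; suff du : d \is a GRing.unit by exists d^-1; rewrite mulrV.
  apply: unit_d => k.
  have [y ->] : exists y, a k = d * y; last by rewrite hnormM dvdn_mulr.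
  apply: (condZ_closed (fun x => exists y, x = d * y) a i' j') => //.
  + by move=> _ _ [x ->] [y ->]; exists (- (x + y)); rewrite mulrN mulrDr.
  + by apply: dab; left.
  + by apply: dab; right.
- by move=> x _; exists x; rewrite mulr1.
- move=> d dab; suff du : d \is a GRing.unit by exists d^-1; rewrite mulVr.
  apply: unit_d => k.
  have [y ->] : exists y, a k = y * d; last by rewrite hnormM dvdn_mull.
  apply: (condZ_closed (fun x => exists y, x = y * d) a i' j') => //.
  + by move=> _ _ [x ->] [y ->]; exists (- (x + y)); rewrite mulNr mulrDl.
  + by apply: dab; left.
  + by apply: dab; right.
Qed.

(** Only the coefficient of the third index [k] is free. The value -1 gives [a j = a k], a non-unit
    common divisor; 0 gives [a j = 0]; 1 gives [a i = 0] by the zero sum. *)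
Lemma condS2_nonunit a : nonzero a -> condZ a -> condG2 a ->
  (forall i, a i \isn't a GRing.unit) -> condS2 a.
Proof.
move=> a0 aZ aG nu.
have neq_lt (i j : 'I_3) : (i < j)%N -> a i <> a j.
  move=> ij aij; have [[_ lg] _] := aG _ _ ij.
  (* If the two entries agree, [a i] is a common left divisor, so it divides 1. *)
  have [|y /(congr1 hnorm)/esym/eqP] := lg (a i).
    by move=> x [|] ->; exists 1; rewrite mulr1.
  rewrite hnormM hnorm1 muln_eq1 => /andP[u _].
  by have := nu i; rewrite unit_hnorm u.
have neq (i j : 'I_3) : i != j -> a i <> a j.
  by rewrite neq_ltn => /orP[/neq_lt//|/neq_lt h /esym].
case=> b [i [j [bc bi bj]]].
have ij : i != j by apply: contra_eq_neq bj => <-; rewrite bi.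
have [k [ki kj _]] := ord3_third i j ij.
have aS : a i + a j + a k = 0 by rewrite -(sum_ord3 _ a i j k).
rewrite (sum_ord3 _ _ i j k)// bi bj mulr0z add0r mulr1z.
have := bc k; rewrite !inE => /or3P[] /eqP->.
- by rewrite mulrN1z => /subr0_eq; apply: neq; rewrite eq_sym.
- by rewrite mulr0z addr0; exact/eqP/a0.
- rewrite mulr1z => ajk; move: aS; rewrite -addrA ajk addr0.
  exact/eqP/a0.
Qed.

Lemma tuplesU_coprime_hnorm a (i j : 'I_3) : condZ a ->
  (forall k, (1 < hnorm (a k))%N) -> coprime (hnorm (a i)) (hnorm (a j)) ->
  nonunits (tuplesU hurwitz 3) a.
Proof.
move=> aZ a_gt1 cop.
have nu k : a k \isn't a GRing.unit by rewrite unit_hnorm gtn_eqF.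
have a0 : nonzero a.
  by move=> k; apply/eqP => ak; have := a_gt1 k; rewrite ak hnorm0.
have aG := condG2_coprime_hnorm a i j aZ cop.
split; last by move=> /(_ i); apply/negP.
by split=> //; exact: condS2_nonunit.
Qed.

(** Coefficients 0 and 1 are among those of (S2), and a common divisor of all entries divides the
    first and the last. *)
Lemma tuplesUA (R : nzRingType) : (tuplesU R 3 `<=` tuplesA R 3)%classic.
Proof.
move=> a [a0 aZ aS aG]; split=> //.
- move=> [b [i [j [bc bi bj bS]]]]; apply: aS; exists b, i, j; split=> // k.
  by have := bc k; rewrite !inE => ->; rewrite orbT.
- have [[_ lg] [_ rg]] := aG ord0 ord_max isT.
  split; split.
  + by move=> x _; exists x; rewrite mul1r.
  + by move=> d dab; apply: lg => _ [] ->; apply: dab; eexists.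
  + by move=> x _; exists x; rewrite mulr1.
  + by move=> d dab; apply: rg => _ [] ->; apply: dab; eexists.
Qed.

End Triples.

(** * Bounding Q below by an injective family *)

Section QualityLimsup.
Variables (K : realType) (n : nat).
Implicit Types (S : set {ffun 'I_n -> hurwitz}) (t : nat -> {ffun 'I_n -> hurwitz}).

(** The family [t] makes the set infinite, and tuples form a countable type, so an enumeration
    exists and [Q] does not take its default value. *)
Lemma is_Q_enum S t : injective t -> (forall k, nonunits S (t k)) ->
  exists2 e : nat -> {ffun 'I_n -> hurwitz},
    set_bij [set: nat] (nonunits S) e &
    is_Q S (limn_esup (fun k => (quality K (e k))%:E)).
Proof.
move=> t_inj tS.
have S_inf : ~ finite_set (nonunits S).
  move=> fin; have : finite_set (t @^-1` nonunits S)%classic.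
    by apply: finite_preimage => // x y _ _; exact: t_inj.
  by apply: sub_infinite_set infinite_nat => k _; exact: tS.
have /card_set_bijP[g [gS g_inj gsurj]] := eq_card_nat (countableP _) S_inf.
(* The enumeration is the inverse of the bijection [g] onto the naturals. *)
have /choice[e eP] k : exists a, nonunits S a /\ g a = k.
  by have [a Sa ga] := gsurj k I; exists a.
suff e_bij : set_bij [set: nat] (nonunits S) e by exists e => //; exists e.
split.
- by move=> k _; have [] := eP k.
- by move=> k l _ _ ekl; have [_ <-] := eP k; have [_ <-] := eP l; rewrite ekl.
- move=> a Sa; exists (g a) => //; have [Se ge] := eP (g a).
  by apply: g_inj; rewrite ?inE.
Qed.

(** [t] is an injective reindexing of part of an enumeration, which cannot raise the upper limit. *)
Lemma limn_esup_le_Q S t : injective t -> (forall k, nonunits S (t k)) ->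
  (limn_esup (fun k => (quality K (t k))%:E) <= Q K S)%E.
Proof.
move=> t_inj tS; have [e [_ _ e_surj] /QE->] := is_Q_enum S t t_inj tS.
have /choice[s sE] k : exists j, e j = t k.
  by have [j _ je] := e_surj _ (tS k); exists j.
under eq_fun do rewrite -sE.
apply: (@limn_esup_inj_le K (fun k => (quality K (e k))%:E) s) => k l.
by move=> skl; apply: t_inj; rewrite -!sE skl.
Qed.

(** An enumeration of the smaller set is an injective family in the larger one. *)
Lemma subset_le_Q S S' t : injective t -> (forall k, nonunits S (t k)) ->
  (S `<=` S')%classic -> (Q K S <= Q K S')%E.
Proof.
move=> t_inj tS SS'; have [e [eS e_inj _] /QE->] := is_Q_enum S t t_inj tS.
apply: limn_esup_le_Q => [k l|k]; first by apply: e_inj; rewrite inE.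
by have [Se nue] := eS k I; split=> //; exact: SS'.
Qed.

End QualityLimsup.

(** * Gaussian triples from powers of 2 + i *)

Fact is_hurwitz_int (a b c d : int) :
  Quat a%:~R b%:~R c%:~R d%:~R \in is_hurwitz.
Proof.
by apply/is_hurwitzP; exists false, a, b, c, d; rewrite /= mul0r !addr0.
Qed.

Definition gauss (x y : int) : hurwitz := Hurwitz (is_hurwitz_int x y 0 0).

Lemma gaussD (x y x' y' : int) :
  gauss x y + gauss x' y' = gauss (x + x') (y + y').
Proof.
apply: val_inj => /=; rewrite !rmorphD /=.
by congr Quat; rewrite addr0.
Qed.

Lemma hnorm_gauss (x y : int) : (hnorm (gauss x y))%:Z = x ^+ 2 + y ^+ 2.
Proof.
apply: (@intr_inj rat); rewrite -[LHS]/((hnorm (gauss x y))%:R) hnormE.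
by rewrite /Defs.normq /=; ring.
Qed.

(** Multiplication of x + y i by 2 + i. *)
Definition gauss_mul21 (p : int * int) := (p.1 *+ 2 - p.2, p.1 + p.2 *+ 2).

(** The power (2 + i)^(k + 1): the shift leaves out the unit 1. *)
Definition pow21 (k : nat) := iter k gauss_mul21 (2, 1).

Lemma norm_pow21 (k : nat) :
  (pow21 k).1 ^+ 2 + (pow21 k).2 ^+ 2 = 5 ^+ k.+1 :> int.
Proof. 
elim: k => [//|k IH]; rewrite [RHS]exprS -{}IH /= /gauss_mul21.
by case: (pow21 k) => x y /=; ring.
Qed.

(** The congruence x = 2 y mod 5 carries the induction: the new imaginary part x + 2 y is then -y
    mod 5. *)
Lemma pow21_mod5 (k : nat) :
  exists2 z : int, (pow21 k).1 = (pow21 k).2 *+ 2 + z * 5 & ~~ (5 %| (pow21 k).2)%Z.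
Proof.
elim: k => [|k [z e1 n5]]; first by exists 0.
exists (- (pow21 k).2); rewrite /= e1; last by lia.
by ring.
Qed.

(** The second entry is minus the conjugate of the first, so their norms agree and the real parts
    cancel. *)
Definition triple (k : nat) : {ffun 'I_3 -> hurwitz} :=
  [ffun i : 'I_3 => nth 0
    [:: gauss (pow21 k).1 (pow21 k).2; gauss (- (pow21 k).1) (pow21 k).2;
        gauss 0 (- ((pow21 k).2 *+ 2))] i].

Definition height (k : nat) : nat := `|(pow21 k).2|%N.

Lemma height_sqr (k : nat) : (height k ^ 2)%N = (pow21 k).2 ^+ 2 :> int.
Proof. by rewrite -mulnn PoszM abszE -expr2 real_normK ?num_real. Qed.

Lemma hnorm_triple (k : nat) (i : 'I_3) :
  hnorm (triple k i) = if (i < 2)%N then (5 ^ k.+1)%N else ((2 * height k) ^ 2)%N.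
Proof.
have nk : (5 ^ k.+1)%N = (pow21 k).1 ^+ 2 + (pow21 k).2 ^+ 2 :> int.
  by rewrite norm_pow21 -natz natrX.
apply/eqP; rewrite -eqz_nat ffunE; case: i => [[|[|[|//]]] ?] /=.
- by rewrite hnorm_gauss nk.
- by rewrite hnorm_gauss sqrrN nk.
- by rewrite hnorm_gauss expnMn PoszM height_sqr; apply/eqP; ring.
Qed.

Lemma height_coprime5 (k : nat) : coprime 5 (height k).
Proof. by have [_ _] := pow21_mod5 k; rewrite prime_coprime. Qed.

Lemma height_gt0 (k : nat) : (0 < height k)%N.
Proof. by have := height_coprime5 k; case: (height k). Qed.

Lemma height_sqr_le (k : nat) : (height k ^ 2 <= 5 ^ k.+1)%N.
Proof.
rewrite -lez_nat height_sqr -[X in _ <= X]natz natrX -norm_pow21.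
by rewrite lerDr sqr_ge0.
Qed.

Lemma triple_inj : injective triple.
Proof.
move=> k l /(congr1 (fun a : {ffun 'I_3 -> hurwitz} => hnorm (a ord0))); rewrite !hnorm_triple /=.
by move=> /eqP; rewrite eqn_exp2l// eqSS => /eqP.
Qed.

Lemma triple_tuplesU (k : nat) : nonunits (tuplesU hurwitz 3) (triple k).
Proof.
apply: (@tuplesU_coprime_hnorm _ ord0 ord_max).
- rewrite /condZ !big_ord_recl big_ord0 !ffunE /= addr0 !gaussD.
  have -> : (pow21 k).1 + (- (pow21 k).1 + 0) = 0 by ring.
  have -> : (pow21 k).2 + ((pow21 k).2 - (pow21 k).2 *+ 2) = 0 by ring.
  exact: val_inj.
- move=> i; rewrite hnorm_triple; case: ifP => _.
    by rewrite -{1}(expn0 5) ltn_exp2l.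
  have := height_gt0 k; nia.
- rewrite !hnorm_triple /= coprimeXl// coprimeXr// coprimeMr.
  by rewrite height_coprime5.
Qed.

(** * Radical and quality of the triples *)

Lemma rad_triple (k : nat) :
  (5 <= Defs.rad (hnorm (\prod_i triple k i)%R) <= 10 * height k)%N.
Proof.
have -> : hnorm (\prod_i triple k i) =
    (5 ^ k.+1 * (5 ^ k.+1 * (2 * height k) ^ 2))%N.
  by rewrite !big_ord_recl big_ord0 mulr1 !hnormM !hnorm_triple.
have h0 := height_gt0 k.
have m_gt0 : (0 < 5 ^ k.+1 * (5 ^ k.+1 * (2 * height k) ^ 2))%N.
  by rewrite !(muln_gt0, expn_gt0) h0.
apply/andP; split.
  by apply: rad_ge_prime => //; rewrite dvdn_mulr// dvdn_exp.
(* The exponent is that of the two factors [5 ^ k.+1] together, and is at least the 2 required by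
   the square. *)
apply: (rad_le _ _ (k.+1 * 2)) => //; first by rewrite muln_gt0.
rewrite (_ : 10 * height k = 5 * (2 * height k))%N; last by rewrite mulnA.
rewrite [((5 * _) ^ _)%N]expnMn mulnA -expnD addnn -muln2 dvdn_mul//.
by rewrite dvdn_exp2l// leq_pmull.
Qed.

(** With N = (k + 1) ln 5 and w = ln 10 / N, the quality is at least N / (w N + N / 2) = 2 / (1 + 2
    w), which is at least 2 - 4 w. *)
Lemma quality_triple (K : realType) (k : nat) :
  2 - 4 * (ln 10 / ln 5) * harmonic k <= quality K (triple k).
Proof.
rewrite /quality; set M := (\max_i _)%N; set r := Defs.rad _.
have M_ge : (5 ^ k.+1 <= M)%N.
  by have := leq_bigmax (F := fun i => hnorm (triple k i)) ord0; rewrite hnorm_triple.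
have /andP[r_ge5 r_le] := rad_triple k.
(* Squaring avoids the square root of [5 ^ k.+1]. *)
have r2_le : (r ^ 2 <= 10 ^ 2 * 5 ^ k.+1)%N.
  apply: (@leq_trans ((10 * height k) ^ 2)); first by rewrite leq_exp2r.
  by rewrite expnMn leq_mul2l height_sqr_le orbT.
have L_gt0 : 0 < ln 5 :> K by rewrite ln_gt0// ltr1n.
have T_gt0 : 0 < ln 10 :> K by rewrite ln_gt0// ltr1n.
have A_ge : k.+1%:R * ln 5 <= ln M%:R :> K.
  rewrite mulr_natl -lnXn// -natrX ler_ln ?posrE ?ltr0n ?expn_gt0 ?ler_nat//.
  by apply: leq_trans M_ge; rewrite expn_gt0.
have B_gt0 : 0 < ln r%:R :> K by rewrite ln_gt0// ltr1n (leq_trans _ r_ge5).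
have r_gt0 : (0 < r)%N by exact: leq_trans r_ge5.
have B_le : 2 * ln r%:R <= 2 * ln 10 + k.+1%:R * ln 5 :> K.
  rewrite !mulr_natl -!lnXn ?ltr0n// -lnM ?posrE ?exprn_gt0 ?ltr0n//.
  rewrite -!natrX -natrM ler_ln ?posrE ?ltr0n ?ler_nat ?muln_gt0 ?expn_gt0//.
  by rewrite r_gt0.
rewrite ler_pdivlMr// /harmonic /=.
set w : K := ln 10 / ln 5 * k.+1%:R^-1.
have w_ge0 : 0 <= w by rewrite /w !mulr_ge0 ?invr_ge0 ?ler0n// ltW.
have Tw : ln 10 = w * (k.+1%:R * ln 5).
  by rewrite /w mulrA !divfK ?pnatr_eq0// gt_eqF.
have nL_gt0 : 0 < k.+1%:R * ln 5 :> K by rewrite mulr_gt0 ?ltr0n.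
apply: le_trans A_ge; rewrite -mulrA -/w; move: B_le; rewrite Tw.
move: (k.+1%:R * ln 5) nL_gt0 (ln r%:R) B_gt0 => N N_gt0 B B_gt0 B_le.
(* The bound on [B] may be multiplied by 2 - 4 w only if this is positive; otherwise the claim is
   trivial. *)
have [c_le0|c_gt0] := lerP (2 - 4 * w) 0.
  by apply: le_trans (ltW N_gt0); rewrite mulr_le0_ge0// ltW.
apply: (@le_trans _ _ ((2 - 4 * w) * (w * N + N / 2))).
  by rewrite ler_pM2l//; lra.
have -> : (2 - 4 * w) * (w * N + N / 2) = N - 4 * (w ^+ 2 * N) by field.
by rewrite gerBl mulr_ge0// mulr_ge0 ?sqr_ge0 ?(ltW N_gt0).
Qed.

(** * Passage to the limit *)

Local Open Scope ereal_scope.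

Theorem theorem4p5 (K : realType) :
  2%:E <= Q K (tuplesU hurwitz 3) /\
  Q K (tuplesU hurwitz 3) <= Q K (tuplesA hurwitz 3).
Proof.
split; last first.
  exact: (subset_le_Q _ _ _ _ _ triple_inj triple_tuplesU (tuplesUA hurwitz)).
apply: le_trans (limn_esup_le_Q _ _ _ _ triple_inj triple_tuplesU).
pose u k := (2 - 4 * (ln 10 / ln 5) * harmonic k : K)%R.
(* The limit 2 is rewritten as the upper limit of [u], to be compared termwise with the
   qualities. *)
have /cvg_limn_einf_sup[_ <-] : ((u k)%:E @[k --> \oo] --> 2%:E)%classic.
  apply: cvg_EFin; first exact: nearW.
  rewrite -(subr0 2%R); apply: cvgB; first exact: cvg_cst.
  rewrite -(mulr0 (4 * (ln 10 / ln 5))%R).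
  by apply: cvgM; [exact: cvg_cst|exact: cvg_harmonic].
apply: le_limn_esup => k; rewrite lee_fin; exact: quality_triple.
Qed.
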